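(* Let $G_1$ be a connected graph containing two distinct vertices $v_1, v_2$, and let $G_2$ be a nontrivial connected graph, vertex-disjoint from $G_1$, containing a vertex $u$. Let $G=G_1(v_2)\diamond G_2(u)$ and $G^*=G_1(v_1)\diamond G_2(u)$. Suppose there exists a Fiedler vector $x$ of $G$ such that $x(v_1)\ge x(v_2)\ge 0$ and all vertices of $G_2$ (as a subgraph of $G$) have nonnegative value under $x$. Then $$\alpha(G^* )\le \alpha(G),$$ with equality if and only if $x(v_1)=x(v_2)=0$, $\sum_{w\in N_{G_2}(u)}x(w)=0$, and $x$ is also a Fiedler vector of $G^*$.
   Context: All graphs are finite and simple. For a graph $G$ on at least two vertices, $L(G)=D(G)-A(G)$ is its Laplacian matrix (degree matrix minus adjacency matrix), the algebraic connectivity $\alpha(G)$ is the second smallest eigenvalue of $L(G)$ (counted with multiplicity), and a Fiedler vector of $G$ is an eigenvector of $L(G)$ corresponding to $\alpha(G)$, orthogonal to the all-one vector. A vector $x$ indexed by $V(G)$ is viewed as a function on $V(G)$, with $x(v)$ the entry at $v$. A graph is trivial if it has only one vertex, and nontrivial otherwise. $N_{G_2}(u)$ is the set of neighbors of $u$ in $G_2$. For vertex-disjoint graphs $G_1,G_2$ with $v\in V(G_1)$, $u\in V(G_2)$, the coalescence $G_1(v)\diamond G_2(u)$ is the graph obtained from $G_1$ and $G_2$ by identifying $v$ with $u$ into a single vertex. Both $G=G_1(v_2)\diamond G_2(u)$ and $G^*=G_1(v_1)\diamond G_2(u)$ are regarded as graphs on the common vertex set $V(G_1)\cup (V(G_2)\setminus\{u\})$,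 where $u$ is identified with $v_2$ in $G$ and with $v_1$ in $G^*$; thus a vector on $V(G)$ is also a vector on $V(G^* )$. In $G$, the vertices of $G_2$ are $v_2$ (in place of $u$) and the vertices of $V(G_2)\setminus\{u\}$. *)

(* Defs.v *)
From HB Require Import structures.
From mathcomp Require Import all_boot all_order all_algebra.
From mathcomp Require Import reals.
From mathcomp Require Import polyrcf.

Set Implicit Arguments.
Unset Strict Implicit.
Unset Printing Implicit Defensive.

Import Order.TTheory GRing.Theory Num.Theory.
Local Open Scope ring_scope.

Record sgraph (V : finType) := SGraph {
  adj : rel V;
  adj_sym : symmetric adj;
  adj_irr : irreflexive adj }.

Definition connected_graph (V : finType) (G : sgraph V) : Prop :=
  (0 < #|V|)%N /\ forall a b : V, connect (adj G) a b.

Definition nontrivial_graph (V : finType) (G : sgraph V) : Prop :=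
  (1 < #|V|)%N.

Definition degree (V : finType) (G : sgraph V) (a : V) : nat :=
  #|[set b | adj G a b]|.

Definition degree_mx (R : realType) (V : finType) (G : sgraph V) : 'M[R]_#|V| :=
  \matrix_(i, j) ((degree G (enum_val i))%:R *+ (i == j)).

Definition adjacency_mx (R : realType) (V : finType) (G : sgraph V) :
    'M[R]_#|V| :=
  \matrix_(i, j) (adj G (enum_val i) (enum_val j))%:R.

Definition laplacian (R : realType) (V : finType) (G : sgraph V) : 'M[R]_#|V| :=
  degree_mx R G - adjacency_mx R G.

(* Real eigenvalues in nondecreasing order: [rootsR p] lists the distinct real
   roots of [p] increasingly, and each one is repeated according to its
   multiplicity as a root of the characteristic polynomial. *)
Definition spectrum (R : realType) (n : nat) (M : 'M[R]_n) : seq R :=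
  flatten [seq nseq (mup a (char_poly M)) a | a <- rootsR (char_poly M)].

(* Second smallest Laplacian eigenvalue; meaningful when [1 < #|V|]. *)
Definition alg_connectivity (R : realType) (V : finType) (G : sgraph V) : R :=
  nth 0 (spectrum (laplacian R G)) 1.

Definition vec_of (R : realType) (V : finType) (x : V -> R) : 'cV[R]_#|V| :=
  \col_i x (enum_val i).

Definition fiedler (R : realType) (V : finType) (G : sgraph V) (x : V -> R) :
    Prop :=
  [/\ vec_of x != 0,
      laplacian R G *m vec_of x = alg_connectivity R G *: vec_of x
    & \sum_a x a = 0].

Section Coalescence.
Variables (V1 V2 : finType) (u : V2).

(* V(G1) together with V(G2) \ {u}; the same type whichever vertex of G1 is
   identified with u. *)
Definition coal_vertex : finType := (V1 + {w : V2 | w != u})%type.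

Definition coal_inl (a : V1) : coal_vertex := inl a.

(* The copy of V(G2) in the coalescence at [v], where u becomes v. *)
Definition coal_inr (v : V1) (w : V2) : coal_vertex :=
  if insub w is Some w' then inr w' else inl v.

Variables (G1 : sgraph V1) (G2 : sgraph V2) (v : V1).

Definition coal_adj (a b : coal_vertex) : bool :=
  match a, b with
  | inl a1, inl b1 => adj G1 a1 b1
  | inl a1, inr b2 => (a1 == v) && adj G2 u (val b2)
  | inr a2, inl b1 => (b1 == v) && adj G2 (val a2) u
  | inr a2, inr b2 => adj G2 (val a2) (val b2)
  end.

Lemma coal_adj_sym : symmetric coal_adj.
Proof. by case=> a [] b /=; rewrite adj_sym. Qed.

Lemma coal_adj_irr : irreflexive coal_adj.
Proof. by case=> a /=; rewrite adj_irr. Qed.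

Definition coalescence : sgraph coal_vertex := SGraph coal_adj_sym coal_adj_irr.

End Coalescence.

Arguments coal_vertex V1 {V2} u.
Arguments coal_inl {V1 V2} u a.
Arguments coal_inr {V1 V2} u v w.
Arguments coalescence {V1 V2} u G1 G2 v.

(* [coal G1 v G2 u] is G1(v) <> G2(u). *)
Notation coal G1 v G2 u := (coalescence u G1 G2 v).

(* Main.v *)
Require Import Defs.
From mathcomp Require Import all_boot all_order all_algebra.
From mathcomp Require Import reals.
From mathcomp Require Import sesquilinear spectral complex polyrcf ring lra.
Import Order.TTheory GRing.Theory Num.Theory.
Local Open Scope ring_scope.

(** Write [Q_H(y)] for the Dirichlet form [\sum_{ab edge} (y a - y b)^2] of a
    graph [H]. The second Laplacian eigenvalue is the minimum of [Q_H(y) / |y|^2]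
    over nonzero [y] orthogonal to the constants, and only eigenvectors attain
    it ([alg_connectivity_min]). Here [Q_H(y)] is the sum of [y a * (L y) a],
    called [energy], so that it splits over a coalescence ([energy_coal]) and
    does not see constants added to [y] ([energy_shift]).

    Write [G] for the coalescence at [v2], [G'] for the one at [v1], and put
    [c = x v1 - x v2 >= 0]. Raising [x] by [c] on the vertices of [G2] other than
    [u] carries the restriction of [x] to [G2] from [v2] to [v1] up to a
    constant, so the Dirichlet form is the same in both coalescences. After
    projection orthogonally to the constants, the squared norm has grown by
    [2 c S + c^2 k m / (k + m)], where [S >= 0] is the sum of [x] over the [k]
    vertices moved and [m] is the number of vertices of [G1]
    ([moved_test_vector_bound]). As [Q_G(x) = alpha(G) |x|^2], this gives
    [alpha(G') <= alpha(G)]; and since [alpha(G) > 0], equality forces [c = 0].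

    In the equality case [x] itself is then a minimizer for [G'], hence a Fiedler
    vector of both graphs. Comparing the two eigenvalue equations at [v2] shows
    that the Laplacian of [G2] annihilates [x] at [u]. As a Laplacian sums to
    zero, [alpha(G)] times the sum of the nonnegative numbers [x w], [w <> u],
    is zero, so these all vanish; the Dirichlet form of [G2] is then zero as
    well, and connectedness makes [x] vanish on [G2]
    ([common_fiedler_eq0]). Conversely, when [x v1 = x v2] the two Dirichlet
    forms agree on [x], and a common Fiedler vector yields equal eigenvalues.

    The variational principle is proved by diagonalizing a real symmetric matrix
    by a unitary matrix over [R[i]]; its real eigenvalues, sorted, form the
    spectrum. *)

Set Implicit Arguments.
Unset Strict Implicit.

(** * The two smallest terms of a sorted sequence *)

Section SortedSeq.
Variables (R : realType) (s : seq R).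
Hypothesis s_sorted : sorted <=%R s.

Let second_le a : a \in behead s -> s`_1 <= a.
Proof.
case: s s_sorted => [|b [|c t]] //= /andP[_ /(order_path_min le_trans)/allP le_t].
by rewrite inE => /orP[/eqP->|/le_t].
Qed.

Lemma lt_second a : a \in s -> a < s`_1 -> a = s`_0.
Proof.
move=> + lt_a; have := @second_le a.
case: s lt_a => // b t /= lt_a le_a; rewrite inE => /orP[/eqP //|/le_a].
by rewrite leNgt lt_a.
Qed.

Lemma count_lt_second : (count (fun a => (a < s`_1)%R) s <= 1)%N.
Proof.
have := second_le; case: s => //= b t le_t.
suff -> : count (fun a => a < t`_0) t = 0%N by rewrite addn0 leq_b1.
by apply/eqP; rewrite -leqn0 leqNgt -has_count; apply/hasPn => a /le_t; rewrite -leNgt.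
Qed.

End SortedSeq.

(** * Spectrum and variational principle for real symmetric matrices *)

Section Spectrum.
Variables (R : realType) (n : nat).
Implicit Types (A : 'M[R]_n) (y e v : 'cV[R]_n).
Local Notation C := (complex R).
Local Notation toC := (real_complex R).
Local Open Scope sesquilinear_scope.

(** A real symmetric matrix is Hermitian over [R[i]], so the complex spectral
    theorem applies and the diagonal entries are real. *)
Lemma sym_mx_spectral A : A^T = A ->
  exists2 P : 'M[C]_n, P \is unitarymx &
  exists r : 'I_n -> R,
    map_mx toC A = P^t* *m diag_mx (\row_i toC (r i)) *m P.
Proof.
move=> Asym.
have realA : map_mx toC A \is a mxOver Num.real.
  by apply/mxOverP => i j; rewrite mxE complex_real.
have hermA : map_mx toC A \is hermsymmx.
  apply: realsym_hermsym realA; apply/is_hermitianmxP.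
  by rewrite expr0 scale1r map_mx_id // map_trmx Asym.
exists (spectralmx (map_mx toC A)); first exact: spectral_unitarymx.
exists (fun i => complex.Re (spectral_diag (map_mx toC A) 0 i)).
have /hermitian_normalmx /orthomx_spectralP {1}-> := hermA.
rewrite invmx_unitary ?spectral_unitarymx //.
congr (_ *m diag_mx _ *m _); apply/rowP => i; rewrite mxE RRe_real //.
by have /mxOverP := hermitian_spectral_diag_real hermA.
Qed.

Lemma sorted_spectrum A : sorted <=%R (spectrum A).
Proof.
have : sorted <%R (rootsR (char_poly A)) by exact: sorted_roots.
rewrite /spectrum; move: (rootsR _) => s.
rewrite lt_sorted_pairwise le_sorted_pairwise.
elim: s => //= a s IHs /andP[a_s s_sorted]; rewrite pairwise_cat IHs // andbT.
apply/andP; split; last first.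
  by elim: (mup _ _) => //= k ->; rewrite andbT; apply/allP => b /nseqP[-> _].
apply/allrelP => b c /nseqP[-> _] /flattenP[t /mapP[d d_s ->] /nseqP[-> _]].
by rewrite ltW // (allP a_s).
Qed.

(** Both sides contain each [a] as often as its multiplicity as a root of the
    characteristic polynomial. *)
Lemma perm_spectrum A (t : seq R) :
  char_poly A = \prod_(a <- t) ('X - a%:P) -> perm_eq (spectrum A) t.
Proof.
move=> charA; apply/allP => a _ /=; apply/eqP.
rewrite -[RHS]mu_prod_XsubC -charA /spectrum count_flatten -map_comp sumnE big_map.
have charA0 : char_poly A != 0 by rewrite monic_neq0 ?char_poly_monic.
have [ra|Nra] := boolP (a \in rootsR (char_poly A)).
  rewrite (bigD1_seq a) ?uniq_roots //= count_nseq /= eqxx mul1n.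
  by rewrite big1 ?addn0 // => b ba; rewrite /= count_nseq /= (negPf ba).
rewrite mupNroot; last first.
  by apply: contra Nra => ra; rewrite -roots_on_rootsR // ra in_itv.
rewrite big1_seq // => b /andP[_ rb]; rewrite /= count_nseq /=.
by case: eqP rb Nra => // -> ->.
Qed.

Section Unitary.
Variables (A : 'M[R]_n) (P : 'M[C]_n) (r : 'I_n -> R).
Hypothesis Pu : P \is unitarymx.
Hypothesis AP : map_mx toC A = P^t* *m diag_mx (\row_i toC (r i)) *m P.

Let PtP : P^t* *m P = 1%:M.
Proof. by rewrite -(invmx_unitary Pu) mulVmx // unitarymx_unit. Qed.

(** Coordinates in the orthonormal eigenbasis formed by the conjugated rows
    of [P]. *)
Let coords y : 'cV[C]_n := P *m map_mx toC y.

(** [A] is unitarily similar to a diagonal matrix; the product is computed over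
    [R[i]] and descends to [R], since the embedding of polynomials is
    injective. *)
Lemma char_poly_spectral : char_poly A = \prod_i ('X - (r i)%:P).
Proof.
apply: (map_poly_inj (real_complex R)).
rewrite map_char_poly rmorph_prod /=.
under eq_bigr do rewrite map_polyXsubC.
transitivity (char_poly (diag_mx (\row_i toC (r i)))); last first.
  rewrite char_poly_trig ?diag_mx_is_trig //.
  by apply: eq_bigr => i _; rewrite !mxE eqxx.
rewrite AP /char_poly /char_poly_mx.
set D := diag_mx _.
have -> : 'X%:M - map_mx polyC (P^t* *m D *m P)
   = map_mx polyC (P^t*) *m ('X%:M - map_mx polyC D) *m map_mx polyC P.
  rewrite mulmxBr mulmxBl -!map_mxM; congr (_ - _).
  by rewrite scalar_mxC -mulmxA -map_mxM PtP map_mx1 mulmx1.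
rewrite !det_mulmx mulrAC -det_mulmx -map_mxM PtP.
by rewrite map_mx1 det1 mul1r.
Qed.

Lemma spectral_perm : perm_eq (spectrum A) (codom r).
Proof.
by apply: perm_spectrum; rewrite char_poly_spectral /codom /image_mem big_map big_enum.
Qed.

(** Parseval's identity. *)
Lemma coords_dot y e :
  toC ((y^T *m e) 0 0) = \sum_i (coords y i 0)^* * coords e i 0.
Proof.
have -> : toC ((y^T *m e) 0 0) = (map_mx toC (y^T *m e)) 0 0 by rewrite [RHS]mxE.
have -> : map_mx toC (y^T *m e) = (coords y)^t* *m coords e.
  rewrite /coords trmx_mul [in RHS]map_mxM -[RHS]mulmxA.
  rewrite [X in _ = _ *m X]mulmxA PtP mul1mx map_mxM; congr (_ *m _).
  by apply/matrixP => i j; rewrite !mxE; apply/esym/CrealP; rewrite complex_real.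
by rewrite mxE; apply: eq_bigr => i _; rewrite !mxE.
Qed.

Lemma coords_mul y i : coords (A *m y) i 0 = toC (r i) * coords y i 0.
Proof.
have PPt : P *m P^t* = 1%:M by apply/unitarymxP.
rewrite /coords map_mxM AP !mulmxA PPt mul1mx -mulmxA mul_diag_mx.
by rewrite !mxE.
Qed.

Lemma coords_inj : injective coords.
Proof.
move=> y e /(congr1 (mulmx (invmx P))); rewrite !mulKmx ?unitarymx_unit //.
move/matrixP=> eq_ye; apply/matrixP=> i j.
by have := eq_ye i j; rewrite !mxE => -[].
Qed.

End Unitary.

Lemma spectrum_sym A : A^T = A ->
  size (spectrum A) = n /\ spectrum A =i eigenvalue A.
Proof.
move=> Asym; have [P Pu [r AP]] := sym_mx_spectral Asym.
have permA := spectral_perm Pu AP; split.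
  by rewrite (perm_size permA) size_codom card_ord.
move=> a; rewrite (perm_mem permA) -[RHS]/(eigenvalue A a).
rewrite eigenvalue_root_char (char_poly_spectral Pu AP) -root_prod_XsubC.
by rewrite /codom /image_mem big_map big_enum.
Qed.

(** In eigenbasis coordinates [c], the difference of the two sides is the sum of
    [(r i - s_1) * |c y i|^2]. At most one index [i] has [r i < s_1]. For such an
    index [s_0 < s_1] is a simple eigenvalue, so [e] spans the [i]-th axis and
    [y], being orthogonal to [e], has no [i]-th coordinate. Hence all terms are
    nonnegative, and they all vanish only if [y] is an eigenvector. *)
Lemma second_eigenvalue_min A e y : A^T = A -> e != 0 ->
  A *m e = (spectrum A)`_0 *: e -> (y^T *m e) 0 0 = 0 ->
  (spectrum A)`_1 * (y^T *m y) 0 0 <= (y^T *m (A *m y)) 0 0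
  /\ (((spectrum A)`_1 * (y^T *m y) 0 0 = (y^T *m (A *m y)) 0 0) ->
      A *m y = (spectrum A)`_1 *: y).
Proof.
move=> Asym e0 Ae ye; have [P Pu [r AP]] := sym_mx_spectral Asym.
have permA := spectral_perm Pu AP.
pose c v i : C := (P *m map_mx toC v) i 0.
have cZ a v i : c (a *: v) i = toC a * c v i.
  by rewrite /c map_mxZ -scalemxAr mxE.
have low i : c y i = 0 \/ (spectrum A)`_1 <= r i.
  have [|lt_r] := leP (spectrum A)`_1 (r i); [by right | left].
  have uniq_low j : r j < (spectrum A)`_1 -> j = i.
    move=> lt_rj; have := count_lt_second (sorted_spectrum A).
    rewrite (permP permA) count_map -sum1_count big_enum_cond sum1_card.
    by move/card_le1_eqP; apply.
  have low0 : r i = (spectrum A)`_0.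
    apply: (lt_second (sorted_spectrum A) _ lt_r).
    by rewrite (perm_mem permA) codom_f.
  (* The coordinate of [e] along an axis of eigenvalue other than [s_0] is 0. *)
  have e_supp j : j != i -> c e j = 0.
    move=> ji; have := coords_mul Pu AP e j; rewrite Ae -/(c _ _) cZ => /eqP.
    rewrite -/(c e j) -subr_eq0 -mulrBl mulf_eq0 => /orP[|/eqP //].
    rewrite -rmorphB fmorph_eq0 subr_eq0 => /eqP eq_rj.
    by rewrite (uniq_low j) ?eqxx // -eq_rj -low0 in ji.
  have := coords_dot Pu y e; rewrite ye rmorph0 (bigD1 i) //= big1 => [/esym/eqP|j ji].
    rewrite addr0 mulf_eq0 conjC_eq0 => /orP[/eqP // | /eqP cei].
    case/eqP: e0; apply: (coords_inj Pu); rewrite map_mx0 mulmx0.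
    apply/colP => j; rewrite [RHS]mxE; have [-> //|] := eqVneq j i.
    exact: e_supp.
  by rewrite -/(c e j) e_supp // mulr0.
have gap_ge0 i : 0 <= (r i - (spectrum A)`_1)%:C%C * (`|c y i| ^+ 2).
  have [->|le_r] := low i; first by rewrite normr0 expr0n mulr0.
  by rewrite mulr_ge0 ?exprn_ge0 // ler0c subr_ge0.
have gapE : toC ((y^T *m (A *m y)) 0 0 - (spectrum A)`_1 * (y^T *m y) 0 0)
    = \sum_i (r i - (spectrum A)`_1)%:C%C * (`|c y i| ^+ 2).
  rewrite rmorphB rmorphM /= !(coords_dot Pu) mulr_sumr -sumrB.
  apply: eq_bigr => i _; rewrite (coords_mul Pu AP) -/(c y i) normCK rmorphB /=.
  by ring.
split.
  by rewrite -subr_ge0 -(ler0c (_ - _)) [X in _ <= X]gapE sumr_ge0.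
move=> /esym/eqP; rewrite -subr_eq0 => /eqP/(congr1 toC).
rewrite gapE rmorph0 => sum0.
apply: (coords_inj Pu); apply/colP => i.
rewrite (coords_mul Pu AP) -!/(c _ i) cZ; apply/eqP.
rewrite -subr_eq0 -mulrBl -rmorphB /=.
have /(_ i isT)/eqP := psumr_eq0P (fun i _ => gap_ge0 i) sum0.
by rewrite mulf_eq0 expf_eq0 /= normr_eq0 => /orP[] /eqP->; rewrite ?mul0r ?mulr0.
Qed.

End Spectrum.


(** * The Laplacian and its Dirichlet form *)

Section Graph.
Variables (R : realType) (V : finType) (G : sgraph V).
Implicit Types x y : V -> R.

Definition lap x (a : V) : R := \sum_(b | adj G a b) (x a - x b).
Definition energy x : R := \sum_a x a * lap x a.

Lemma eq_lap x y : x =1 y -> lap x =1 lap y.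
Proof. by move=> xy a; apply: eq_bigr => b _; rewrite !xy. Qed.

Lemma eq_energy x y : x =1 y -> energy x = energy y.
Proof. by move=> xy; apply: eq_bigr => a _; rewrite xy (eq_lap xy). Qed.

Lemma lap_shift x c : lap (fun a => x a + c) =1 lap x.
Proof. by move=> a; apply: eq_bigr => b _; rewrite opprD addrACA subrr addr0. Qed.

(** Symmetry of adjacency: reversing every edge permutes the terms. *)
Lemma exchange_adj (F : V -> V -> R) :
  \sum_a \sum_(b | adj G a b) F a b = \sum_a \sum_(b | adj G a b) F b a.
Proof.
rewrite (exchange_big_dep xpredT) //=.
by apply: eq_bigr => a _; apply: eq_bigl => b; rewrite adj_sym.
Qed.

Lemma sum_lap x : \sum_a lap x a = 0.
Proof.
suff : \sum_a lap x a = - \sum_a lap x a by lra.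
rewrite [LHS](exchange_adj (fun a b => x a - x b)) -sumrN.
apply: eq_bigr => a _; rewrite /lap -sumrN.
by apply: eq_bigr => b _; rewrite opprB.
Qed.

Lemma energy_shift x c : energy (fun a => x a + c) = energy x.
Proof.
rewrite /energy; under eq_bigr do rewrite lap_shift mulrDl.
by rewrite big_split /= -mulr_sumr sum_lap mulr0 addr0.
Qed.

(** Summation by parts; every edge is counted once in each direction, whence
    the factor two. *)
Lemma energyE x : energy x *+ 2 = \sum_a \sum_(b | adj G a b) (x a - x b) ^+ 2.
Proof.
have -> : energy x = \sum_a \sum_(b | adj G a b) x a * (x a - x b).
  by apply: eq_bigr => a _; rewrite mulr_sumr.
rewrite mulr2n {2}exchange_adj -big_split; apply: eq_bigr => a _ /=.
rewrite -big_split; apply: eq_bigr => b _ /=; ring.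
Qed.

Lemma energy_ge0 x : 0 <= energy x.
Proof.
rewrite -(@pmulrn_lge0 _ _ 2) // energyE.
by apply: sumr_ge0 => a _; apply: sumr_ge0 => b _; apply: sqr_ge0.
Qed.

Lemma energy_eq0 x : connected_graph G -> energy x = 0 -> forall a b, x a = x b.
Proof.
move=> [_ conn] e0 a b.
have step c d : adj G c d -> x c = x d.
  move=> cd; have /eqP := energyE x; rewrite e0 mul0rn eq_sym.
  have in_ge0 c' : 0 <= \sum_(b | adj G c' b) (x c' - x b) ^+ 2.
    by apply: sumr_ge0 => d' _; apply: sqr_ge0.
  rewrite psumr_eq0 // => /allP/(_ c (mem_index_enum c))/=.
  rewrite psumr_eq0 => [/allP/(_ d (mem_index_enum d))/=|d' _]; last exact: sqr_ge0.
  by rewrite cd sqrf_eq0 subr_eq0 => /eqP.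
have /connectP[p + ->] := conn a b.
by elim: p a => //= c p IHp a /andP[/step-> /IHp].
Qed.

Lemma sum_enum_val (F : V -> R) : \sum_(i < #|V|) F (enum_val i) = \sum_a F a.
Proof. by rewrite [RHS](reindex _ (onW_bij _ (enum_val_bij V))). Qed.

Lemma vec_of_dot x y : ((vec_of x)^T *m vec_of y) 0 0 = \sum_a x a * y a.
Proof.
rewrite mxE -(sum_enum_val (fun a => x a * y a)).
by apply: eq_bigr => i _; rewrite !mxE.
Qed.

Lemma vec_ofK (v : 'cV[R]_#|V|) : vec_of (fun a => v (enum_rank a) 0) = v.
Proof. by apply/colP => i; rewrite mxE enum_valK. Qed.

Lemma laplacian_vec x : laplacian R G *m vec_of x = vec_of (lap x).
Proof.
apply/colP => i; rewrite !mxE /lap sumrB sumr_const.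
under eq_bigr do rewrite !mxE mulrBl.
rewrite sumrB; congr (_ - _).
  rewrite (bigD1 i) //= eqxx big1 => [|j /negPf ji].
    by rewrite addr0 mulr_natl /degree cardsE.
  by rewrite eq_sym ji mulr0n mul0r.
rewrite (sum_enum_val (fun b => (adj G (enum_val i) b)%:R * x b)).
by rewrite [RHS]big_mkcond; apply: eq_bigr => b _; case: adj; rewrite ?mul1r ?mul0r.
Qed.

Lemma laplacian_sym : (laplacian R G)^T = laplacian R G.
Proof.
apply/matrixP => i j; rewrite !mxE adj_sym eq_sym.
by have [->|_] := eqVneq i j; rewrite ?mulr0n.
Qed.

(** The energy of an eigenvector is the eigenvalue times its squared norm. *)
Lemma laplacian_spectrum_ge0 (a : R) : a \in spectrum (laplacian R G) -> 0 <= a.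
Proof.
have [_ ->] := spectrum_sym laplacian_sym => /eigenvalueP[v vL v0].
pose x b := v^T (enum_rank b) 0.
have xv : vec_of x = v^T by rewrite vec_ofK.
have Lx : vec_of (lap x) = a *: vec_of x.
  by rewrite -laplacian_vec xv -{1}laplacian_sym -trmx_mul vL linearZ.
have eE : energy x = a * \sum_b x b * x b.
  by rewrite /energy -vec_of_dot Lx -scalemxAr mxE vec_of_dot.
have := energy_ge0 x; rewrite eE; apply: contraTT; rewrite -!ltNge => a0.
rewrite nmulr_rlt0 // lt_neqAle sumr_ge0 => [|b _]; last exact: sqr_ge0.
rewrite andbT eq_sym psumr_eq0 => [|b _]; last exact: sqr_ge0.
apply: contraNN v0 => /allP x0.
rewrite -[v]trmxK -xv; apply/eqP/rowP => i; rewrite !mxE.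
by have := x0 _ (mem_index_enum (enum_val i)); rewrite /= mulf_eq0 orbb => /eqP.
Qed.

(** Constants are harmonic, so zero belongs to the spectrum, which has no
    negative element. *)
Lemma laplacian_spectrum0 : (0 < #|V|)%N -> (spectrum (laplacian R G))`_0 = 0.
Proof.
move=> V0; have [size_s mem_s] := spectrum_sym laplacian_sym.
have s0 : 0 \in spectrum (laplacian R G).
  rewrite mem_s; apply/eigenvalueP; exists (vec_of (fun=> 1 : R))^T.
    rewrite -{1}laplacian_sym -trmx_mul laplacian_vec scale0r.
    apply/rowP => i; rewrite !mxE /lap big1 // => b _; exact: subrr.
  apply/eqP => /rowP/(_ (Ordinal V0)); rewrite !mxE; apply/eqP; exact: oner_neq0.
apply/eqP; rewrite eq_le; apply/andP; split; last first.
  by apply: laplacian_spectrum_ge0; rewrite mem_nth // size_s.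
have /(nthP 0)[k lt_k s_k] := s0; rewrite -[leRHS]s_k.
by apply: (sorted_leq_nth le_trans le_refl 0 (sorted_spectrum _));
  rewrite ?inE // size_s.
Qed.

(** [second_eigenvalue_min] with the constant vector as eigenvector of the
    lowest eigenvalue. *)
Lemma alg_connectivity_min x : (0 < #|V|)%N -> \sum_a x a = 0 ->
  alg_connectivity R G * (\sum_a x a ^+ 2) <= energy x
  /\ (alg_connectivity R G * (\sum_a x a ^+ 2) = energy x ->
      forall a, lap x a = alg_connectivity R G * x a).
Proof.
move=> V0 sum_x.
have ones_neq0 : vec_of (fun=> 1 : R) != 0 :> 'cV_#|V|.
  by apply/eqP => /colP/(_ (Ordinal V0)); rewrite !mxE; apply/eqP/oner_neq0.
have L1 : laplacian R G *m vec_of (fun=> 1)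
    = (spectrum (laplacian R G))`_0 *: vec_of (fun=> 1).
  rewrite laplacian_spectrum0 // scale0r laplacian_vec.
  by apply/colP => i; rewrite !mxE /lap big1 // => b _; exact: subrr.
have := second_eigenvalue_min laplacian_sym ones_neq0 L1 (y := vec_of x).
rewrite laplacian_vec !vec_of_dot; under eq_bigr do rewrite mulr1.
move=> /(_ sum_x)[le_x eq_x]; split; first by under eq_bigr do rewrite expr2.
move=> eq_e a; have /colP/(_ (enum_rank a)) :
    vec_of (lap x) = alg_connectivity R G *: vec_of x.
  by apply: eq_x; rewrite -[RHS]eq_e; under [in RHS]eq_bigr do rewrite expr2.
by rewrite !mxE enum_rankK.
Qed.

Lemma fiedlerP x :
  fiedler G x <-> [/\ 0 < \sum_a x a ^+ 2,
    forall a, lap x a = alg_connectivity R G * x a & \sum_a x a = 0].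
Proof.
split=> [[x0 Lx sum_x]|[x0 Lx sum_x]]; split=> //.
- rewrite lt_neqAle sumr_ge0 ?andbT => [|a _]; last exact: sqr_ge0.
  apply: contraNneq x0 => /esym/eqP; rewrite psumr_eq0 => [/allP x0|a _]; last exact: sqr_ge0.
  apply/eqP/colP => i; rewrite !mxE.
  by have := x0 _ (mem_index_enum (enum_val i)); rewrite /= sqrf_eq0 => /eqP.
- move=> a; move: Lx; rewrite laplacian_vec => /colP/(_ (enum_rank a)).
  by rewrite !mxE enum_rankK.
- apply: contraTneq x0 => x0; rewrite big1 ?ltxx // => a _.
  by move/colP/(_ (enum_rank a)): x0; rewrite !mxE enum_rankK => ->; rewrite expr0n.
- by rewrite laplacian_vec; apply/colP => i; rewrite !mxE Lx.
Qed.

Lemma fiedler_energy x : fiedler G x ->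
  energy x = alg_connectivity R G * \sum_a x a ^+ 2.
Proof.
move=> /fiedlerP[_ Lx _]; rewrite mulr_sumr; apply: eq_bigr => a _.
by rewrite Lx mulrCA expr2.
Qed.

End Graph.

(** * Coalescences *)

Section Coalescence.
Variables (R : realType) (V1 V2 : finType) (u : V2).
Implicit Types x : coal_vertex V1 u -> R.

Lemma coal_inr_root (v : V1) : coal_inr u v u = inl v.
Proof. by rewrite /coal_inr insubF ?eqxx. Qed.

Lemma coal_inr_val (v : V1) (w : {w : V2 | w != u}) : coal_inr u v (val w) = inr w.
Proof. by rewrite /coal_inr valK. Qed.

Lemma coal_inr_sub (v : V1) (w : V2) (wu : w != u) :
  coal_inr u v w = inr (Sub w wu).
Proof. by rewrite /coal_inr insubT. Qed.

Lemma sum_coal (v : V1) (F : coal_vertex V1 u -> R) :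
  \sum_a F a = \sum_a F (inl a) + \sum_(w | w != u) F (coal_inr u v w).
Proof.
rewrite big_sumType /=; congr (_ + _).
rewrite (big_sub (fun w => w != u) (fun w => F (coal_inr u v w))).
by apply: eq_bigr => w _; rewrite coal_inr_val.
Qed.

Variables (G1 : sgraph V1) (G2 : sgraph V2) (v : V1) (x : coal_vertex V1 u -> R).
Let x1 a := x (inl a).
Let x2 w := x (coal_inr u v w).

Lemma lap_coal_inl a :
  lap (coal G1 v G2 u) x (inl a) = lap G1 x1 a + lap G2 x2 u *+ (a == v).
Proof.
rewrite /lap big_mkcond (sum_coal v) -big_mkcond /=; congr (_ + _).
have [->|_] := eqVneq a v; last first.
  by rewrite big1 // => w wu; rewrite (coal_inr_sub _ wu).
rewrite mulr1n [RHS]big_mkcond [RHS](bigD1 u) //= adj_irr add0r.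
apply: eq_bigr => w wu; rewrite /x2 coal_inr_root.
by rewrite (coal_inr_sub _ wu).
Qed.

Lemma lap_coal_inr w : w != u ->
  lap (coal G1 v G2 u) x (coal_inr u v w) = lap G2 x2 w.
Proof.
move=> wu; rewrite (coal_inr_sub _ wu) /lap big_mkcond (sum_coal v).
rewrite [RHS]big_mkcond [RHS](bigD1 u) //= /x2 coal_inr_root (coal_inr_sub _ wu).
congr (_ + _).
  rewrite (bigD1 v) //= eqxx big1 ?addr0 // => a /negPf av.
  by rewrite av.
apply: eq_bigr => b bu.
by rewrite (coal_inr_sub _ bu).
Qed.

Lemma energy_coal : energy (coal G1 v G2 u) x = energy G1 x1 + energy G2 x2.
Proof.
rewrite /energy (sum_coal v) [in RHS](bigD1 (P := xpredT) u) //=.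
under eq_bigr do rewrite lap_coal_inl mulrDr.
under [X in _ + X = _]eq_bigr => w wu do rewrite lap_coal_inr //.
rewrite big_split /= -addrA; congr (_ + (_ + _)).
rewrite (bigD1 v) //= eqxx big1 ?addr0 ?/x2 ?coal_inr_root // => a /negPf->.
by rewrite mulr0n mulr0.
Qed.

End Coalescence.

(** The edges of a coalescence are those of [G1] and those of [G2], and the
    contribution of [G2] is unchanged by the constant [c]. *)
Lemma energy_coal_move (R : realType) (V1 V2 : finType) (u : V2)
    (G1 : sgraph V1) (G2 : sgraph V2) (v1 v2 : V1)
    (x y : coal_vertex V1 u -> R) (c : R) :
  (forall a, y (inl a) = x (inl a)) ->
  (forall w, y (coal_inr u v1 w) = x (coal_inr u v2 w) + c) ->
  energy (coal G1 v1 G2 u) y = energy (coal G1 v2 G2 u) x.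
Proof.
move=> y1 y2; rewrite !energy_coal (eq_energy _ y1) (eq_energy _ y2).
by rewrite energy_shift.
Qed.

(** * Moving the coalesced graph *)

Section Main.
Variables (R : realType) (V1 V2 : finType).
Variables (G1 : sgraph V1) (G2 : sgraph V2) (v1 v2 : V1) (u : V2).
Hypotheses (hG1 : connected_graph G1) (hv : v1 <> v2).
Hypotheses (hG2 : connected_graph G2) (hG2nt : nontrivial_graph G2).
Variable x : coal_vertex V1 u -> R.
Hypothesis hx : fiedler (coal G1 v2 G2 u) x.
Hypothesis hx12 : x (coal_inl u v1) >= x (coal_inl u v2).
Hypothesis hxG2 : forall w : V2, 0 <= x (coal_inr u v2 w).
Local Notation G := (coal G1 v2 G2 u).
Local Notation G' := (coal G1 v1 G2 u).
Local Notation alpha := (alg_connectivity R G).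
Local Notation alpha' := (alg_connectivity R G').

Let card_moved_gt0 : (0 < #|predC1 u|)%N.
Proof. by rewrite cardC1 -subn1 subn_gt0. Qed.

Let coal_gt0 : (0 < #|coal_vertex V1 u|)%N.
Proof. by apply/card_gt0P; exists (inl v1). Qed.

Let norm_gt0 : 0 < \sum_a x a ^+ 2.
Proof. by have /fiedlerP[] := hx. Qed.

(** If the eigenvalue were zero, [x] would have no energy on [G1] nor on [G2],
    hence be constant on each; these share a vertex, so [x] would be constant
    with sum zero. *)
Lemma alg_connectivity_coal_gt0 : 0 < alpha.
Proof.
have eE := fiedler_energy hx.
have : 0 <= alpha * \sum_a x a ^+ 2 by rewrite -eE energy_ge0.
rewrite pmulr_lge0 // le_eqVlt => /orP[/eqP a0|//].
move: eE; rewrite -a0 mul0r energy_coal => /eqP.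
rewrite paddr_eq0 ?energy_ge0 // => /andP[/eqP e1 /eqP e2].
have x1c := energy_eq0 hG1 e1; have x2c := energy_eq0 hG2 e2.
have xc a : x a = x (inl v2).
  case: a => a; first exact: x1c.
  by rewrite -(coal_inr_val v2) (x2c _ u) coal_inr_root.
have /fiedlerP[_ _] := hx; under eq_bigr do rewrite xc.
rewrite sumr_const => /eqP; rewrite mulrn_eq0 -leqn0 leqNgt coal_gt0 /= => /eqP x0.
by move: norm_gt0; rewrite big1 ?ltxx // => a _; rewrite xc x0 expr0n.
Qed.

(** The test vector is [x], raised by [c] on the moved vertices and then made
    orthogonal to the constants; the factor of [alpha'] is its squared norm. *)
Lemma moved_test_vector_bound (c : R) (n := (#|V1| + #|predC1 u|)%:R : R) :
  x (inl v1) = x (inl v2) + c ->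
  alpha' * (\sum_a x a ^+ 2 + (c * \sum_(w | w != u) x (coal_inr u v2 w)) *+ 2
            + c ^+ 2 * (#|predC1 u|%:R * #|V1|%:R / n)) <= energy G x.
Proof.
move=> cE.
have n0 : n != 0.
  by rewrite pnatr_eq0 -lt0n addn_gt0; have [-> _] := hG1.
have nE : n = #|V1|%:R + #|predC1 u|%:R by rewrite /n natrD.
move: n n0 nE => n n0 nE.
(* [t] is the mean of the raised vector, as [x] sums to zero. *)
have [t tE] : exists t, t * n = c * #|predC1 u|%:R.
  by exists (c * #|predC1 u|%:R / n); rewrite divfK.
pose z (a : coal_vertex V1 u) : R := x a + (if a is inr _ then c else 0) - t.
have sum_z (F : R -> R) : \sum_a F (z a)
    = \sum_a F (x (inl a) - t) + \sum_(w | w != u) F (x (coal_inr u v2 w) + (c - t)).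
  rewrite (sum_coal v2); congr (_ + _).
    by apply: eq_bigr => a _; rewrite /z addr0.
  apply: eq_bigr => w wu; by rewrite /z (coal_inr_sub _ wu) addrA.
have sum_x : \sum_a x (inl a) + \sum_(w | w != u) x (coal_inr u v2 w) = 0.
  by have /fiedlerP[_ _] := hx; rewrite (sum_coal v2).
have cst1 (d : R) : \sum_(a : V1) d = d * #|V1|%:R by rewrite sumr_const mulr_natr.
have cst2 (d : R) : \sum_(w | w != u) d = d * #|predC1 u|%:R.
  by rewrite sumr_const mulr_natr.
have z0 : \sum_a z a = 0.
  rewrite (sum_z id) big_split big_split /= cst1 cst2.
  rewrite addrACA sum_x add0r; move: tE; rewrite nE; lra.
have -> : energy G x = energy G' z.
  symmetry; rewrite -(energy_shift _ z t).
  apply: (@energy_coal_move _ _ _ _ _ _ _ _ _ _ c) => [a|w]; first by rewrite subrK addr0.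
  rewrite subrK; have [->|wu] := eqVneq w u.
    by rewrite !coal_inr_root addr0.
  by rewrite !(coal_inr_sub _ wu).
have [+ _] := alg_connectivity_min G' coal_gt0 z0.
congr (alpha' * _ <= _).
rewrite (sum_z (fun r => r ^+ 2)) (sum_coal v2 (fun a => x a ^+ 2)).
have sq I (P : pred I) (r : seq I) (f : I -> R) d :
  \sum_(i <- r | P i) (f i + d) ^+ 2 = \sum_(i <- r | P i) f i ^+ 2
    + (d * \sum_(i <- r | P i) f i) *+ 2 + \sum_(i <- r | P i) d ^+ 2.
  rewrite mulr_sumr -sumrMnl -!big_split; apply: eq_bigr => i _ /=; ring.
rewrite sq sq cst1 cst2.
move: sum_x tE n0 nE.
set s1 := \sum_a x (inl a); set s2 := \sum_(w | w != u) x (coal_inr u v2 w).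
move: s1 s2 => s1 s2.
set S1 := \sum_a x (inl a) ^+ 2; set S2 := \sum_(w | w != u) _ ^+ 2.
move: S1 S2 => S1 S2.
move: (#|V1|%:R : R) (#|predC1 u|%:R : R) => m k sum_x tE n0 nE.
have -> : t = c * k / n by rewrite -tE mulfK.
have -> : s1 = - s2 by apply/eqP; rewrite -addr_eq0 sum_x.
by rewrite nE in n0 *; field.
Qed.

(** The numerator of the Rayleigh quotient stays [alpha |x|^2], while the
    denominator grows, strictly unless [c = 0]. *)
Lemma alg_connectivity_moved : alpha' <= alpha /\
  (alpha' = alpha -> x (inl v1) = x (inl v2)).
Proof.
have [c cE] : exists c, x (inl v1) = x (inl v2) + c.
  by exists (x (inl v1) - x (inl v2)); rewrite addrC subrK.
have c_ge0 : 0 <= c by rewrite -(lerDl (x (inl v2))) -cE.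
have := moved_test_vector_bound cE; rewrite (fiedler_energy hx).
have := alg_connectivity_coal_gt0; have := norm_gt0.
have S2 : 0 <= c * \sum_(w | w != u) x (coal_inr u v2 w).
  by rewrite mulr_ge0 // sumr_ge0.
have V10 : (0 < #|V1|)%N by have [] := hG1.
have r0 : 0 < #|predC1 u|%:R * #|V1|%:R / (#|V1| + #|predC1 u|)%:R :> R.
  by rewrite !mulr_gt0 ?invr_gt0 ?ltr0n ?addn_gt0 ?V10.
move: r0 S2; set r := _ / _; set s := c * _ => r0 s0 N0 a0.
set N := \sum_a x a ^+ 2 in N0 * => le_N.
have gap_ge0 : 0 <= s *+ 2 + c ^+ 2 * r.
  by rewrite addr_ge0 ?mulrn_wge0 // mulr_ge0 ?sqr_ge0 // ltW.
split=> [|eq_a].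
  rewrite leNgt; apply/negP => lt_a.
  have : alpha * N < alpha' * N by rewrite ltr_pM2r.
  rewrite ltNge (le_trans _ le_N) // ler_pM2l ?(lt_trans a0) //.
  by rewrite -addrA lerDl.
move: le_N; rewrite eq_a ler_pM2l // -addrA gerDl => gap_le0.
have c2 : c ^+ 2 * r <= 0 by move: (mulrn_wge0 2 s0); lra.
suff : c = 0 by rewrite cE => ->; rewrite addr0.
by apply/eqP; rewrite -sqrf_eq0 eq_le sqr_ge0 andbT -(pmulr_lle0 _ r0).
Qed.

Lemma energy_move : x (inl v1) = x (inl v2) -> energy G' x = energy G x.
Proof.
move=> eq_x; apply: (@energy_coal_move _ _ _ _ _ _ _ _ _ _ 0) => // w.
rewrite addr0; have [->|wu] := eqVneq w u; first by rewrite !coal_inr_root.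
by rewrite !(coal_inr_sub _ wu).
Qed.

(** [x] has the same Rayleigh quotient in both graphs, so it attains the
    minimum for [G'] too. *)
Lemma fiedler_moved : alpha' = alpha -> x (inl v1) = x (inl v2) ->
  fiedler G' x.
Proof.
move=> eq_a /energy_move eq_e.
have /fiedlerP[N0 _ sum_x] := hx; apply/fiedlerP; split=> //.
have [_] := alg_connectivity_min G' coal_gt0 sum_x; apply.
by rewrite eq_e (fiedler_energy hx) eq_a.
Qed.

(** At [v2] the two Laplacians differ only by the term that [G2] contributes,
    so this term vanishes. The Laplacian of [G2] sums to zero and equals
    [alpha * x w] off [u], so the nonnegative values [x w] with [w != u] sum to
    zero. *)
Lemma common_fiedler_eq0 : alpha' = alpha -> fiedler G' x ->
  forall w, x (coal_inr u v2 w) = 0.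
Proof.
move=> eq_a /fiedlerP[_ Lx' _]; have /fiedlerP[_ Lx _] := hx.
pose g w := x (coal_inr u v2 w).
have lap_u : lap G2 g u = 0.
  (* Only in [G] is [G2] attached at [v2]. *)
  have := Lx (inl v2); have := Lx' (inl v2); rewrite eq_a => <-.
  rewrite !lap_coal_inl eqxx [v2 == v1]eq_sym (introF eqP hv) mulr0n mulr1n addr0.
  by move/eqP; rewrite -subr_eq0 addrAC subrr add0r => /eqP.
have lap_g w : w != u -> lap G2 g w = alpha * g w.
  by move=> wu; rewrite -Lx lap_coal_inr.
have sum_g : \sum_(w | w != u) g w = 0.
  apply: (mulfI (lt0r_neq0 alg_connectivity_coal_gt0)).
  rewrite mulr0 mulr_sumr -(eq_bigr _ lap_g).
  by rewrite -[RHS](sum_lap G2 g) [RHS](bigD1 u) //= lap_u add0r.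
have g0 w : w != u -> g w = 0.
  by move=> wu; apply: (psumr_eq0P _ sum_g) => // w' _; exact: hxG2.
have e0 : energy G2 g = 0.
  rewrite /energy (bigD1 u) //= lap_u mulr0 add0r big1 // => w wu.
  by rewrite g0 ?mul0r.
have /card_gt0P[w wu] := card_moved_gt0.
by move=> w'; rewrite -/(g w') (energy_eq0 hG2 e0 w' w) g0.
Qed.

Lemma alg_connectivity_moved_eq : alpha' = alpha <->
  [/\ x (inl v1) = 0, x (inl v2) = 0,
      \sum_(w | adj G2 u w) x (coal_inr u v2 w) = 0 & fiedler G' x].
Proof.
split=> [eq_a|[x1 x2 _ fx]].
  have eq_x : x (inl v1) = x (inl v2) by have [_] := alg_connectivity_moved; apply.
  have fx := fiedler_moved eq_a eq_x.
  have x2 := common_fiedler_eq0 eq_a fx.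
  have xv2 : x (inl v2) = 0 by rewrite -(coal_inr_root (V2 := V2) u) x2.
  by split=> //; [rewrite eq_x | rewrite big1].
have eq_e : energy G' x = energy G x by apply: energy_move; rewrite x1 x2.
apply: (mulIf (lt0r_neq0 norm_gt0)).
by rewrite -(fiedler_energy hx) -(fiedler_energy fx).
Qed.

End Main.

Unset Implicit Arguments.
Set Strict Implicit.

Theorem lemma2p4 (R : realType) (V1 V2 : finType)
    (G1 : sgraph V1) (G2 : sgraph V2) (v1 v2 : V1) (u : V2)
    (hG1 : connected_graph G1) (hv : v1 <> v2)
    (hG2 : connected_graph G2) (hG2nt : nontrivial_graph G2)
    (x : coal_vertex V1 u -> R)
    (hx : fiedler (coal G1 v2 G2 u) x)
    (hx12 : x (coal_inl u v1) >= x (coal_inl u v2))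
    (hx2 : x (coal_inl u v2) >= 0)
    (hxG2 : forall w : V2, 0 <= x (coal_inr u v2 w)) :
  alg_connectivity R (coal G1 v1 G2 u) <= alg_connectivity R (coal G1 v2 G2 u)
  /\ (alg_connectivity R (coal G1 v1 G2 u)
        = alg_connectivity R (coal G1 v2 G2 u)
      <-> [/\ x (coal_inl u v1) = 0,
              x (coal_inl u v2) = 0,
              \sum_(w : V2 | adj G2 u w) x (coal_inr u v2 w) = 0
            & fiedler (coal G1 v1 G2 u) x]).
Proof.
have [le_a eq_x] := alg_connectivity_moved hG1 hG2 hG2nt hx hx12 hxG2.
split=> //; exact: alg_connectivity_moved_eq.
Qed.
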